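(* Let $n\ge 2$ and let $\lambda=(\lambda_1,0,\dots,0)\in\mathbb{R}^n$ with $\lambda_1<\tfrac32-n$. Then $$\|(\lambda-s)^++\rho\|^2\ge\|\lambda+\rho\|^2$$ holds for every Schmid module $s=s_{a,b}=(2b+a,a,0,\dots,0)$, where $a,b\ge 0$ are integers.
   Context: This is the case $\mathfrak{g}_0=\mathfrak{so}(2,2n-1)$. Here $\rho=(n-\tfrac12,n-\tfrac32,\dots,\tfrac12)$ and $\|\cdot\|$ is the standard Euclidean norm on $\mathbb{R}^n$. The Weyl group $W_{\mathfrak{k}}$ is generated by the reflections in $\varepsilon_i\pm\varepsilon_j$, $2\le i<j\le n$, and in $\varepsilon_i$, $2\le i\le n$, so it acts by all permutations and sign changes of the coordinates $2,\dots,n$ (fixing the first coordinate). For $\mu\in\mathbb{R}^n$, $\mu^+$ denotes the unique $W_{\mathfrak{k}}$-conjugate of $\mu$ satisfying $\mu_2\ge\mu_3\ge\dots\ge\mu_n\ge 0$. Schmid modules are identified with the $n$-tuples $s_{a,b}=(2b+a,a,0,\dots,0)$ with integers $a,b\ge 0$. *)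

(* Defs.v *)
From HB Require Import structures.
From mathcomp Require Import all_boot all_order all_fingroup all_algebra.
From mathcomp Require Import boolp classical_sets reals.

Set Implicit Arguments.
Unset Strict Implicit.
Unset Printing Implicit Defensive.

Import Order.TTheory GRing.Theory Num.Theory.
Local Open Scope ring_scope.

(** Vectors of R^n are row vectors ['rV[R]_n].  Coordinates are numbered from
    0, so the coordinates 1, ..., n of the mathematical text are the indices
    0, ..., n-1 here. *)

Section Defs.
Variables (R : realType) (n : nat).
Implicit Types (x mu nu alpha : 'rV[R]_n) (w : 'rV[R]_n -> 'rV[R]_n).

Definition inner x mu : R := \sum_(i < n) x 0 i * mu 0 i.

(* Euclidean; the library's norm on ['rV[R]_n] is the sup norm. *)
Definition enorm x : R := Num.sqrt (inner x x).

Definition eps (i : 'I_n) : 'rV[R]_n := delta_mx 0 i.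

Definition reflection alpha x : 'rV[R]_n :=
  x - (2 * inner x alpha / inner alpha alpha) *: alpha.

Definition compact_root alpha : Prop :=
  (exists i j : 'I_n, (0 < i < j)%N /\
     (alpha = eps i - eps j \/ alpha = eps i + eps j)) \/
  (exists i : 'I_n, (0 < i)%N /\ alpha = eps i).

(* Closure under composition only: reflections are involutions, so the
   monoid they generate is a group. *)
Inductive Wk : ('rV[R]_n -> 'rV[R]_n) -> Prop :=
| Wk_id : Wk id
| Wk_reflection alpha w :
    compact_root alpha -> Wk w -> Wk (reflection alpha \o w).

Definition Wk_conjugate mu nu : Prop := exists2 w, Wk w & nu = w mu.

Definition Wk_dominant mu : Prop :=
  (forall i j : 'I_n, (0 < i)%N -> (i <= j)%N -> mu 0 j <= mu 0 i) /\
  (forall i : 'I_n, (0 < i)%N -> 0 <= mu 0 i).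

(* The default value [mu] of [xget] is never used: see
   [dominant_conjugateP] and [dominant_conjugate_unique] below. *)
Definition dominant_conjugate mu : 'rV[R]_n :=
  xget mu [set nu | Wk_conjugate mu nu /\ Wk_dominant nu]%classic.

Definition rho : 'rV[R]_n := \row_(i < n) (n%:R - 2^-1 - (i : nat)%:R).

Definition first_axis (l1 : R) : 'rV[R]_n :=
  \row_(i < n) (if (i : nat) == 0%N then l1 else 0).

Definition schmid (a b : nat) : 'rV[R]_n :=
  \row_(i < n) (if (i : nat) == 0%N then (2 * b + a)%:R
                else if (i : nat) == 1%N then a%:R else 0).

Lemma inner_eps x i : inner x (eps i) = x 0 i.
Proof.
rewrite /inner (bigD1 i) //= big1 ?addr0 => [|j ji].
  by rewrite !mxE !eqxx mulr1.
by rewrite !mxE eqxx (negPf ji) mulr0.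
Qed.

Lemma innerDr x mu nu : inner x (mu + nu) = inner x mu + inner x nu.
Proof. by rewrite -big_split; apply: eq_bigr => i _; rewrite mxE mulrDr. Qed.

Lemma innerNr x mu : inner x (- mu) = - inner x mu.
Proof. by rewrite -sumrN; apply: eq_bigr => i _; rewrite mxE mulrN. Qed.

Lemma reflection_eps x (i k : 'I_n) :
  reflection (eps i) x 0 k = if k == i then - x 0 i else x 0 k.
Proof.
rewrite /reflection !inner_eps !mxE !eqxx /= divr1.
case: (eqVneq k i) => [->|_]; last by rewrite mulr0 subr0.
by rewrite mulr1 mulr_natl mulr2n opprD addrA subrr sub0r.
Qed.

Lemma reflection_swap x (i j k : 'I_n) : i != j ->
  reflection (eps i - eps j) x 0 k = x 0 (tperm i j k).
Proof.
move=> ij; have ji : (j == i) = false by rewrite eq_sym (negPf ij).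
have E : inner (eps i - eps j) (eps i - eps j) = 2.
  by rewrite innerDr innerNr !inner_eps !mxE !eqxx /= (negPf ij) ji subr0 sub0r opprK.
rewrite /reflection E innerDr innerNr !inner_eps mulrC mulKf ?pnatr_eq0 // !mxE !eqxx /=.
case: tpermP => [->|->|/eqP/negPf -> /eqP/negPf ->].
- by rewrite eqxx (negPf ij) subr0 mulr1 opprB addrC subrK.
- by rewrite eqxx ji sub0r mulrN1 opprK addrC subrK.
- by rewrite subr0 mulr0 subr0.
Qed.

Lemma reflection_nswap x (i j k : 'I_n) : i != j ->
  reflection (eps i + eps j) x 0 k =
  if (k == i) || (k == j) then - x 0 (tperm i j k) else x 0 k.
Proof.
move=> ij; have ji : (j == i) = false by rewrite eq_sym (negPf ij).
have E : inner (eps i + eps j) (eps i + eps j) = 2.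
  by rewrite innerDr !inner_eps !mxE !eqxx /= (negPf ij) ji addr0 add0r.
rewrite /reflection E innerDr !inner_eps mulrC mulKf ?pnatr_eq0 // !mxE !eqxx /=.
case: tpermP => [->|->|/eqP/negPf -> /eqP/negPf ->] /=.
- by rewrite eqxx (negPf ij) addr0 mulr1 opprD addrA subrr sub0r.
- by rewrite eqxx ji add0r mulr1 addrC opprD subrK.
- by rewrite addr0 mulr0 subr0.
Qed.

Lemma Wk_signed_perm w mu : Wk w ->
  exists2 p : 'S_n, (forall k : 'I_n, k = 0%N :> nat ->
                       p k = k /\ w mu 0 k = mu 0 k) &
    forall k, `|w mu 0 k| = `|mu 0 (p k)|.
Proof.
elim=> [|alpha {}w Ha _ [p p0 pE]].
  by exists 1%g => k; rewrite perm1.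
have step (q : 'S_n) : (forall k : 'I_n, k = 0%N :> nat -> q k = k /\
    reflection alpha (w mu) 0 k = w mu 0 k) ->
    (forall k, `|reflection alpha (w mu) 0 k| = `|w mu 0 (q k)|) ->
    exists2 p : 'S_n, (forall k : 'I_n, k = 0%N :> nat ->
      p k = k /\ (reflection alpha \o w) mu 0 k = mu 0 k) &
      forall k, `|(reflection alpha \o w) mu 0 k| = `|mu 0 (p k)|.
  move=> q0 qE; exists (q * p)%g => k /=; last by rewrite permM qE pE.
  move=> k0; rewrite permM; have [-> ->] := q0 _ k0.
  exact: p0.
case: Ha => [[i [j [/andP[i0 lij] Ha]]]|[i [i0 Ha]]]; last subst alpha.
  have ij : i != j by rewrite -val_eqE neq_ltn lij.
  have j0 := ltn_trans i0 lij.
  apply: (step (tperm i j)) => k.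
    move=> k0; have ki : (k == i) = false by rewrite -val_eqE /= k0 ltn_eqF.
    have kj : (k == j) = false by rewrite -val_eqE /= k0 ltn_eqF.
    have tk : tperm i j k = k by rewrite tpermD // eq_sym ?ki ?kj.
    split=> //; case: Ha => ->; first by rewrite (reflection_swap _ _ ij) tk.
    by rewrite (reflection_nswap _ _ ij) ki kj.
  case: Ha => ->; first by rewrite (reflection_swap _ _ ij).
  rewrite (reflection_nswap _ _ ij); case: tpermP => [->|->|/eqP/negPf -> /eqP/negPf -> //].
    by rewrite eqxx normrN.
  by rewrite eqxx orbT normrN.
apply: (step 1%g) => k; rewrite perm1 reflection_eps.
  by move=> k0; rewrite -val_eqE /= k0 ltn_eqF.
by case: eqP => [->|//]; rewrite normrN.
Qed.

Lemma Wk_conjugate_step mu nu alpha : compact_root alpha ->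
  Wk_conjugate mu nu -> Wk_conjugate mu (reflection alpha nu).
Proof.
by move=> Ha [w Hw ->]; exists (reflection alpha \o w) => //; constructor.
Qed.

Lemma dominant_conjugate_exists mu :
  exists nu, Wk_conjugate mu nu /\ Wk_dominant nu.
Proof.
have [nu0 cnu0 nu0_ge0] : exists2 nu, Wk_conjugate mu nu &
    forall i : 'I_n, (0 < i)%N -> 0 <= nu 0 i.
  suff /(_ n) [nu ? H] : forall k, exists2 nu, Wk_conjugate mu nu &
      forall i : 'I_n, (0 < i)%N -> (i < k)%N -> 0 <= nu 0 i.
    by exists nu => // i i0; exact: H.
  elim=> [|k [nu cnu H]]; first by exists mu => //; exists id => //; constructor.
  have [kn|kn] := ltnP k n; last first.
    by exists nu => // i i0 _; apply: H => //; exact: leq_trans kn.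
  pose m := Ordinal kn.
  have [/andP[m0 mlt]|Hm] := boolP ((0 < m)%N && (nu 0 m < 0)).
    exists (reflection (eps m) nu).
      by apply: Wk_conjugate_step => //; right; exists m.
    move=> i i0 ik; rewrite reflection_eps; case: eqP => [_|/eqP im].
      by rewrite oppr_ge0 ltW.
    by apply: H => //; rewrite ltn_neqAle -ltnS ik andbT.
  exists nu => // i i0; rewrite ltnS leq_eqVlt => /orP[/eqP ik|]; last exact: H.
  have im : i = m by exact: val_inj.
  by move: Hm; rewrite -im i0 -leNgt.
suff /(_ n) [nu [cnu H0 H]] : forall k, exists nu, [/\ Wk_conjugate mu nu,
    forall i : 'I_n, (0 < i)%N -> 0 <= nu 0 i &
    forall i j : 'I_n, (0 < i)%N -> (i < k)%N -> (i <= j)%N -> nu 0 j <= nu 0 i].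
  by exists nu; split=> //; split=> // i j i0 ij; apply: H.
elim=> [|k [nu [cnu H0 H]]]; first by exists nu0.
have [kn|kn] := ltnP k n; last first.
  by exists nu; split=> // i j i0 _; apply: H => //; exact: leq_trans kn.
pose c := Ordinal kn.
have [k0|k0] := posnP k.
  by exists nu; split=> // i j i0; rewrite k0 ltnS leqNgt i0.
pose m := [arg max_(j > c | (c <= j)%N) nu 0 j]%O.
have [cm Hm] : (c <= m)%N /\ forall j : 'I_n, (c <= j)%N -> nu 0 j <= nu 0 m.
  by rewrite /m; case: arg_maxP => //= i ci Hi; split.
have [mc|mc] := eqVneq c m.
  exists nu; split=> // i j i0; rewrite ltnS leq_eqVlt => /orP[/eqP ik|]; last exact: H.
  have -> : i = c by exact: val_inj.
  by rewrite {2}mc; exact: Hm.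
have lcm : (c < m)%N by rewrite ltn_neqAle val_eqE mc.
exists (reflection (eps c - eps m) nu); split.
- by apply: Wk_conjugate_step => //; left; exists c, m; rewrite k0 lcm; split=> //; left.
- move=> i i0; rewrite reflection_swap //; apply: H0.
  by case: tpermP => // _; rewrite // (leq_trans k0).
- move=> i j i0; rewrite !reflection_swap // ltnS leq_eqVlt => /orP[/eqP ik|ik] ij.
    have ic : i = c by exact: val_inj.
    rewrite ic tpermL; apply: Hm; rewrite ic in ij.
    by case: tpermP.
  have -> : tperm c m i = i.
    by apply: tpermD; rewrite -val_eqE neq_ltn /= ?ik ?(leq_trans ik) ?orbT.
  apply: H => //; case: tpermP => [_|_|//]; last exact: ltnW.
  exact: leq_trans (ltnW ik) cm.
Qed.

Lemma dominant_conjugate_unique mu nu1 nu2 :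
  Wk_conjugate mu nu1 -> Wk_dominant nu1 ->
  Wk_conjugate mu nu2 -> Wk_dominant nu2 -> nu1 = nu2.
Proof.
pose I := [seq i : 'I_n <- enum 'I_n | (0 < i)%N].
have inI i : (i \in I) = (0 < i)%N by rewrite mem_filter mem_enum andbT.
pose t nu := [seq nu 0 i | i <- I].
have tP nu : Wk_conjugate mu nu -> Wk_dominant nu ->
    perm_eq (t nu) [seq `|mu 0 i| | i <- I] /\ sorted >=%O (t nu).
  move=> [w Hw ->] [Hs H0]; have [p p0 pE] := Wk_signed_perm mu Hw.
  split.
    have -> : t (w mu) = [seq `|mu 0 i| | i <- map p I].
      rewrite -map_comp; apply/eq_in_map => i /=.
      by rewrite inI => i0; rewrite -pE ger0_norm ?H0.
    apply: perm_map; apply: uniq_perm.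
    - by rewrite (map_inj_uniq perm_inj) filter_uniq ?enum_uniq.
    - by rewrite filter_uniq ?enum_uniq.
    - have pgt0 i : (0 < p i)%N = (0 < i)%N.
        apply/idP/idP; rewrite !lt0n; apply: contra => /eqP i0.
          by have [-> _] := p0 _ i0; rewrite i0.
        have [/perm_inj E _] := p0 _ i0.
        by rewrite -E i0.
      by move=> i; rewrite -(permKV p i) (mem_map perm_inj) !inI pgt0.
  rewrite /t sorted_map.
  have: sorted (fun i j : 'I_n => (i <= j)%N) I.
    apply: sorted_filter; first by move=> ? ? ?; exact: leq_trans.
    by rewrite -(sorted_map (f := val) (e' := leq)) val_enum_ord iota_sorted.
  have: all (fun i : 'I_n => (0 < i)%N) I by exact: filter_all.
  by apply: sub_in_sorted => i j i0 _ /= ij; apply: Hs.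
move=> c1 d1 c2 d2; have [P1 S1] := tP _ c1 d1; have [P2 S2] := tP _ c2 d2.
have E : t nu1 = t nu2.
  apply: (sorted_eq (leT := >=%O)) => //; first exact: ge_trans.
    exact: ge_anti.
  by rewrite (perm_trans P1) // perm_sym.
apply/rowP => i; have [i0|i0] := posnP i.
  case: c1 c2 => w1 W1 -> [w2 W2 ->].
  have [p1 /(_ i i0) [_ ->] _] := Wk_signed_perm mu W1.
  by have [p2 /(_ i i0) [_ ->] _] := Wk_signed_perm mu W2.
by move/eq_in_map: E; apply; rewrite inI.
Qed.

Lemma dominant_conjugateP mu :
  Wk_conjugate mu (dominant_conjugate mu) /\
  Wk_dominant (dominant_conjugate mu).
Proof.
exact: (@xgetPex _ mu [set nu | Wk_conjugate mu nu /\ Wk_dominant nu]%classic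
            (dominant_conjugate_exists mu)).
Qed.

End Defs.

(* Main.v *)
Require Import Defs.
From mathcomp Require Import all_boot all_order all_algebra.
From mathcomp Require Import reals.
From mathcomp Require Import lra.

Import Order.TTheory GRing.Theory Num.Theory.
Local Open Scope ring_scope.

(** The vector [lambda - s] is [(l1 - 2b - a, -a, 0, ..., 0)], and flipping the
    sign of its second coordinate makes it dominant, so that
    [(lambda - s)^+ = (l1 - 2b - a, a, 0, ..., 0)]
    ([dominant_conjugate_first_axis_sub_schmid]).  After adding [rho], only the
    first two coordinates differ from those of [lambda + rho].  Put
    [c = 2b + a] and [t = l1 + n - 1/2]; the hypothesis on [l1] says [t < 1].
    The difference of the squared norms is
    [c^2 - 2 t c + a^2 + 2 a (n - 3/2)], and [t < 1], [n >= 2] bound it below by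
    [c^2 - 2 c + a^2 + a = 4 b (b - 1) + 4 a b + a (2 a - 1)],
    which is nonnegative because [a] and [b] are natural numbers: [x^2 >= x]
    holds for integers ([norm_gap_ge0]). *)

Lemma sqr_enorm (R : realType) n (x : 'rV[R]_n) :
  enorm x ^+ 2 = \sum_(i < n) x 0 i ^+ 2.
Proof.
rewrite /enorm sqr_sqrtr /inner; last by apply: sumr_ge0 => i _; rewrite -expr2 sqr_ge0.
by apply: eq_bigr => i _; rewrite expr2.
Qed.

(** The reflection in the second coordinate vector carries [lambda - s] to the
    vector on the right, which is dominant; uniqueness of dominant conjugates
    concludes. *)
Lemma dominant_conjugate_first_axis_sub_schmid (R : realType) m (l1 : R) a b :
  dominant_conjugate (first_axis m.+2 l1 - schmid R m.+2 a b) =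
  \row_(i < m.+2) (if (i : nat) == 0%N then l1 - (2 * b + a)%:R
                   else if (i : nat) == 1%N then a%:R else 0).
Proof.
set mu := _ - _; have [conj_mu dom_mu] := dominant_conjugateP mu.
apply: (dominant_conjugate_unique conj_mu dom_mu).
  pose i1 : 'I_m.+2 := lift ord0 ord0.
  exists (reflection (eps R i1) \o id).
    by constructor; [right; exists i1 | constructor].
  apply/rowP => k; rewrite /= reflection_eps !mxE -val_eqE /=.
  by case: k => [[|[|k]] ?] //=; rewrite sub0r ?opprK ?oppr0.
split=> [[[|i] hi] [[|j] hj]|[[|i] hi]] //= _; last by rewrite !mxE /=; case: ifP.
rewrite !mxE /= !eqSS; case: j {hj} => [|j] //=; first by rewrite ltnS leqn0 => /eqP ->.
by case: ifP.
Qed.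

(** Here [c = 2b + a] is the first coordinate of [s], [l1 + r0 = t] with [r0]
    the first coordinate of [rho], and [r0 - 1] is the second one. *)
Lemma norm_gap_ge0 (R : realDomainType) (l1 r0 : R) (a b : nat) :
  l1 + r0 <= 1 -> 3 <= 2 * r0 ->
  (l1 + r0) ^+ 2 + (r0 - 1) ^+ 2 <=
  (l1 - (2 * b + a)%:R + r0) ^+ 2 + (a%:R + (r0 - 1)) ^+ 2.
Proof.
move=> t_le1 r0_ge.
have nat_sqr k : (k%:R : R) <= k%:R ^+ 2.
  by rewrite -natrX ler_nat; case: k => // k; rewrite leq_pmull.
have a_sqr := nat_sqr a; have b_sqr := nat_sqr b.
rewrite natrD natrM.
(* The difference of the two sides is the sum of 2 * ct_le, ar_ge and the
   polynomial 4 b (b - 1) + 4 a b + a (2 a - 1). *)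
have a_ge0 : 0 <= a%:R :> R by [].
have b_ge0 : 0 <= b%:R :> R by [].
have ab_ge0 := mulr_ge0 a_ge0 b_ge0.
have ct_le : 0 <= (2 * b%:R + a%:R) * (1 - (l1 + r0)).
  by rewrite mulr_ge0 ?subr_ge0 // addr_ge0 // mulr_ge0.
have ar_ge : 0 <= a%:R * (2 * r0 - 3) by rewrite mulr_ge0 // subr_ge0.
lra.
Qed.

Theorem theorem3p89 (R : realType) (n : nat) (hn : (2 <= n)%N) (l1 : R)
  (hl1 : l1 < 3 / 2 - n%:R) (a b : nat) :
  enorm (dominant_conjugate (first_axis n l1 - schmid R n a b) + rho R n) ^+ 2
    >= enorm (first_axis n l1 + rho R n) ^+ 2.
Proof.
case: n hn hl1 => [|[|m]] // _ hl1.
rewrite dominant_conjugate_first_axis_sub_schmid !sqr_enorm !big_ord_recl !addrA.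
apply: lerD; last by apply: ler_sum => i _; rewrite !mxE.
rewrite !mxE /= add0r subr0; apply: norm_gap_ge0; first by lra.
have m_ge0 : 0 <= m%:R :> R by [].
by rewrite -[m.+2]addn2 natrD; lra.
Qed.
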